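(* Let $\gamma\in[0,1)$, let $k\ge0$ be an integer, and suppose that $f\in\mathcal{B}(\Omega_\gamma)$ has the expansion $$f(z)=\sum_{n=k}^{\infty}a_n\left(z+\frac{\gamma}{1-\gamma}\right)^n,\qquad z\in\Omega_\gamma.$$ Put $a=|a_k|/(1-\gamma)^k$. Then $$\sum_{n=k}^{\infty}\frac{|a_n|}{(1-\gamma)^{n}}\rho^n+\left(\frac{\rho^{-k}}{1+a}+\frac{\rho^{1-k}}{1-\rho}\right)\|f\|_\rho^2\le 1$$ for $\rho\le\rho_k^*$, where $\rho_k^*$ is the positive root in $(0,1)$ of the equation $$\rho^{k+1}-3\rho^k-2\rho+2=0$$ (the assertion being for those $k$ for which such a root exists). The radius $\rho_k^*$ is best possible.
   Context: For $\gamma\in[0,1)$, $\Omega_\gamma=\{z\in\mathbb{C}:|z+\frac{\gamma}{1-\gamma}|<\frac{1}{1-\gamma}\}$. For a domain $\Omega\subseteq\mathbb{C}$, $\mathcal{B}(\Omega)$ is the class of analytic functions $f$ on $\Omega$ with $f(\Omega)\subseteq\overline{\mathbb{D}}$, where $\mathbb{D}$ is the open unit disk. For $f(z)=\sum_{n=k}^\infty a_n(z+\frac{\gamma}{1-\gamma})^n$ on $\Omega_\gamma$, $\|f\|_\rho^2=\sum_{n=k}^{\infty}\frac{|a_n|^2}{(1-\gamma)^{2n}}\rho^{2n}$. The variable $\rho$ ranges over $(0,1)$. ''Best possible'' means that $\rho_k^*$ cannot be replaced by a larger number: for every $\rho\in(\rho_k^*,1)$ there is a function $f$ satisfying the hypotheses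 for which the inequality fails at $\rho$. *)

(* Defs.v *)
From Stdlib Require Import Reals.
From Coquelicot Require Import Coquelicot.
Open Scope R_scope.

Definition Omega (gamma : R) (z : C) : Prop :=
  Cmod (z + RtoC (gamma / (1 - gamma)))%C < 1 / (1 - gamma).

(* The base field is given explicitly: differentiability is over C, not over R. *)
Definition classB (D : C -> Prop) (f : C -> C) : Prop :=
  (forall z : C, D z -> @ex_derive C_AbsRing C_NormedModule f z) /\
  (forall z : C, D z -> Cmod (f z) <= 1).

(* All series over n >= k are written with the index shifted to k + n, n >= 0;
   the values of the coefficient sequence below k play no role. *)
Definition has_expansion (gamma : R) (k : nat) (a : nat -> C) (f : C -> C)
  : Prop :=
  forall z : C, Omega gamma z ->
    @is_series C_AbsRing C_NormedModule
      (fun n => a (k + n)%nat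
                * Cpow (z + RtoC (gamma / (1 - gamma))) (k + n))%C (f z).

Definition majorant_term (gamma : R) (k : nat) (a : nat -> C) (rho : R)
  (n : nat) : R :=
  Cmod (a (k + n)%nat) / (1 - gamma) ^ (k + n) * rho ^ (k + n).

Definition normsq_term (gamma : R) (k : nat) (a : nat -> C) (rho : R)
  (n : nat) : R :=
  Cmod (a (k + n)%nat) ^ 2 / (1 - gamma) ^ (2 * (k + n)) * rho ^ (2 * (k + n)).

Definition normsq (gamma : R) (k : nat) (a : nat -> C) (rho : R) : R :=
  Series (normsq_term gamma k a rho).

Definition bohr_lhs (gamma : R) (k : nat) (a : nat -> C) (rho : R) : R :=
  Series (majorant_term gamma k a rho)
  + (powerRZ rho (- Z.of_nat k) / (1 + Cmod (a k) / (1 - gamma) ^ k)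
     + powerRZ rho (1 - Z.of_nat k) / (1 - rho))
    * normsq gamma k a rho.

(* [Series] takes a default value on divergent series, so convergence has to be
   stated separately for [bohr_lhs] to be meaningful. *)
Definition bohr_converges (gamma : R) (k : nat) (a : nat -> C) (rho : R)
  : Prop :=
  ex_series (majorant_term gamma k a rho) /\
  ex_series (normsq_term gamma k a rho).

(* Main.v *)
Require Import Defs.
From Stdlib Require Import Reals Lra Lia Bool.
From Coquelicot Require Import Coquelicot.
Open Scope R_scope.

(** Put [c_n = a_(k+n) / (1-gamma)^(k+n)].  The substitution
    [w = (1-gamma) z + gamma] turns [f] into a function [w^k h(w)] on the unit
    disk, bounded by 1, with [h(w) = sum c_n w^n], and the left-hand side of
    the inequality becomes

      [rho^k (sum |c_n| rho^n + (1/(1+a) + rho/(1-rho)) sum |c_n|^2 rho^(2n))],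

    where [a = |c_0|].

    The analytic input is that multiplication by [h] does not increase the
    [l^2] norm of a polynomial, coefficientwise ([contraction]).  Averaging
    over roots of unity on a circle [|w| = r] proves it: the factor [w^k] has
    the constant modulus [r^k] there, which tends to 1 with [r].

    Applied to suitable test polynomials, the contraction property gives the
    sharp coefficient bounds of Carlson ([carlson_odd], [carlson_even]),

      [|c_(2n+1)| <= 1 - |c_0|^2 - ... - |c_n|^2],
      [|c_(2n)| <= 1 - |c_0|^2 - ... - |c_(n-1)|^2 - |c_n|^2 / (1+a)].

    When these are multiplied by the powers of [rho] and summed, the total
    weight of [-|c_n|^2] (for [n >= 1]) is
    [rho^(2n)/(1+a) + rho^(2n+1) + rho^(2n+2) + ...], that is
    [(1/(1+a) + rho/(1-rho)) rho^(2n)]: exactly the weight of [|c_n|^2] in the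
    norm term.  What remains ([bohr_series]) is
    [rho^k (a + a^2/(1+a) + rho/(1-rho))], which is largest at [a = 1], where it
    equals [rho^k (3/2 + rho/(1-rho))].  This function of [rho] is strictly
    increasing and takes the value 1 at the root of the given equation.  It is
    attained by the unimodular monomial [w^k], whence the sharpness. *)

(** * Finite sums *)

(** Sums over [i < n], with the empty sum available: this makes products of
    truncated series and splittings of index ranges free of off-by-one cases. *)
Fixpoint Rsum (u : nat -> R) (n : nat) : R :=
  match n with O => 0 | S m => Rsum u m + u m end.

Fixpoint Csum (u : nat -> C) (n : nat) : C :=
  match n with O => 0%C | S m => (Csum u m + u m)%C end.

Lemma Rsum_ext (u v : nat -> R) (n : nat) :
  (forall i, (i < n)%nat -> u i = v i) -> Rsum u n = Rsum v n.
Proof.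
  induction n as [|n IH]; intros H; simpl; auto.
  rewrite IH by (intros; apply H; lia). now rewrite H by lia.
Qed.

Lemma Rsum_le (u v : nat -> R) (n : nat) :
  (forall i, (i < n)%nat -> u i <= v i) -> Rsum u n <= Rsum v n.
Proof.
  induction n as [|n IH]; intros H; simpl; [lra|].
  apply Rplus_le_compat; [apply IH; intros; apply H|apply H]; lia.
Qed.

Lemma Rsum_plus (u v : nat -> R) (n : nat) :
  Rsum (fun i => u i + v i) n = Rsum u n + Rsum v n.
Proof. induction n as [|n IH]; simpl; [|rewrite IH]; ring. Qed.

Lemma Rsum_scal (c : R) (u : nat -> R) (n : nat) :
  Rsum (fun i => c * u i) n = c * Rsum u n.
Proof. induction n as [|n IH]; simpl; [|rewrite IH]; ring. Qed.

Lemma Rsum_const (c : R) (n : nat) : Rsum (fun _ => c) n = INR n * c.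
Proof. induction n as [|n IH]; [|rewrite S_INR]; simpl; [|rewrite IH]; ring. Qed.

Lemma Rsum_nonneg (u : nat -> R) (n : nat) :
  (forall i, 0 <= u i) -> 0 <= Rsum u n.
Proof. intros H; induction n as [|n IH]; simpl; [lra|]. specialize (H n); lra. Qed.

Lemma Rsum_mono (u : nat -> R) (m n : nat) :
  (forall i, 0 <= u i) -> (m <= n)%nat -> Rsum u m <= Rsum u n.
Proof.
  intros H Hmn; induction Hmn as [|n _ IH]; simpl; [lra|]. specialize (H n); lra.
Qed.

Lemma Rsum_sum_n (u : nat -> R) (n : nat) : sum_n u n = Rsum u (S n).
Proof.
  induction n as [|n IH].
  - rewrite sum_O. simpl. ring.
  - rewrite sum_Sn, IH. reflexivity.
Qed.

Lemma Csum_ext (u v : nat -> C) (n : nat) :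
  (forall i, (i < n)%nat -> u i = v i) -> Csum u n = Csum v n.
Proof.
  induction n as [|n IH]; intros H; simpl; auto.
  rewrite IH by (intros; apply H; lia). now rewrite H by lia.
Qed.

Lemma Csum_zero (u : nat -> C) (n : nat) :
  (forall i, (i < n)%nat -> u i = 0%C) -> Csum u n = 0%C.
Proof.
  induction n as [|n IH]; intros H; simpl; auto.
  rewrite IH by (intros; apply H; lia). rewrite H by lia. ring.
Qed.

Lemma Csum_plus (u v : nat -> C) (n : nat) :
  Csum (fun i => u i + v i)%C n = (Csum u n + Csum v n)%C.
Proof. induction n as [|n IH]; simpl; [|rewrite IH]; ring. Qed.

Lemma Csum_scal (c : C) (u : nat -> C) (n : nat) :
  Csum (fun i => c * u i)%C n = (c * Csum u n)%C.
Proof. induction n as [|n IH]; simpl; [|rewrite IH]; ring. Qed.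

Lemma Csum_swap (u : nat -> nat -> C) (m n : nat) :
  Csum (fun i => Csum (u i) n) m = Csum (fun j => Csum (fun i => u i j) m) n.
Proof.
  induction m as [|m IH]; simpl.
  - symmetry. now apply Csum_zero.
  - rewrite IH. now rewrite <- Csum_plus.
Qed.

Lemma Csum_add (u : nat -> C) (m n : nat) :
  Csum u (m + n) = (Csum u m + Csum (fun i => u (m + i)%nat) n)%C.
Proof.
  induction n as [|n IH]; simpl.
  - rewrite Nat.add_0_r. ring.
  - rewrite Nat.add_succ_r. simpl. rewrite IH. ring.
Qed.

Lemma Csum_sum_n (u : nat -> C) (n : nat) :
  @sum_n C_AbelianMonoid u n = Csum u (S n).
Proof.
  induction n as [|n IH].
  - rewrite sum_O. simpl. ring.
  - rewrite sum_Sn, IH. reflexivity.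
Qed.

Lemma Cmod_Csum (u : nat -> C) (n : nat) :
  Cmod (Csum u n) <= Rsum (fun i => Cmod (u i)) n.
Proof.
  induction n as [|n IH]; simpl; [rewrite Cmod_0; lra|].
  eapply Rle_trans; [apply Cmod_triangle|]. lra.
Qed.

(** * Parseval's identity over the roots of unity *)

Definition cis (t : R) : C := (cos t, sin t).

Lemma Cmod_cis (t : R) : Cmod (cis t) = 1.
Proof.
  apply Rsqr_inj; [apply Cmod_ge_0|lra|].
  rewrite !Rsqr_pow2, Cmod2_alt. unfold cis, Re, Im; simpl fst; simpl snd.
  generalize (sin2_cos2 t). rewrite !Rsqr_pow2. lra.
Qed.

Lemma cis_pow (t : R) (n : nat) : (cis t ^ n)%C = cis (INR n * t).
Proof.
  induction n as [|n IH].
  - simpl. unfold cis. now rewrite Rmult_0_l, cos_0, sin_0.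
  - rewrite Cpow_S, IH, S_INR. unfold cis.
    replace ((INR n + 1) * t) with (t + INR n * t) by ring.
    rewrite cos_plus, sin_plus. unfold Cmult; simpl. f_equal; ring.
Qed.

Lemma geom_Csum (z : C) (n : nat) :
  ((z - 1) * Csum (fun i => z ^ i) n)%C = (z ^ n - 1)%C.
Proof.
  induction n as [|n IH]; simpl.
  - ring.
  - rewrite Cmult_plus_distr_l, IH. ring.
Qed.

Lemma cis_neq_1 (t : R) : 0 < t < 2 * PI -> cis t <> 1%C.
Proof.
  intros Ht H. assert (Hc : cos t = 1) by (apply (f_equal fst) in H; exact H).
  replace t with (2 * (t / 2)) in Hc by field. rewrite cos_2a_sin in Hc.
  assert (0 < sin (t / 2)) by (apply sin_gt_0; lra). nra.
Qed.

(** Orthogonality of the characters of the cyclic group of order [N]: the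
    terms form a geometric progression with ratio [z <> 1], [z^N = 1]. *)
Lemma roots_sum_zero (N l : nat) : (0 < l < N)%nat ->
  Csum (fun j => cis (2 * PI / INR N * INR j) ^ l)%C N = 0%C.
Proof.
  intros Hl. assert (HN : 0 < INR N) by (apply lt_0_INR; lia).
  assert (Hl0 : 0 < INR l) by (apply lt_0_INR; lia).
  assert (HlN : INR l < INR N) by (apply lt_INR; lia).
  set (z := cis (INR l * (2 * PI / INR N))).
  rewrite (Csum_ext _ (fun j => z ^ j)%C).
  2: { intros j _. unfold z. rewrite !cis_pow. f_equal. ring. }
  assert (Hz : z <> 1%C).
  { apply cis_neq_1. pose proof PI_RGT_0. split.
    - apply Rmult_lt_0_compat; [lra|]. apply Rdiv_lt_0_compat; lra.
    - replace (INR l * (2 * PI / INR N)) with (2 * PI * (INR l / INR N)) by (field; lra).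
      rewrite <- (Rmult_1_r (2 * PI)) at 2. apply Rmult_lt_compat_l; [lra|].
      apply Rlt_div_l; lra. }
  assert (Hz1 : (z - 1)%C <> 0%C).
  { intros H. apply Hz. replace z with ((z - 1) + 1)%C by ring. rewrite H. ring. }
  assert (HzN : (z ^ N)%C = 1%C).
  { unfold z. rewrite cis_pow.
    replace (INR N * (INR l * (2 * PI / INR N))) with (0 + 2 * INR l * PI)
      by (field; lra).
    unfold cis. rewrite cos_period, sin_period, cos_0, sin_0. reflexivity. }
  pose proof (geom_Csum z N) as G. rewrite HzN in G.
  replace (Csum (fun i => z ^ i)%C N) with (/ (z - 1) * ((z - 1) * Csum (fun i => z ^ i) N))%C
    by (field; exact Hz1).
  rewrite G. ring.
Qed.

Lemma Cmod2_plus (a b : C) :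
  Cmod (a + b) ^ 2 = Cmod a ^ 2 + Cmod b ^ 2 + 2 * Re (a * Cconj b).
Proof. rewrite !Cmod2_alt. destruct a, b. unfold Re, Im; simpl. ring. Qed.

Lemma Re_plus (a b : C) : Re (a + b) = Re a + Re b.
Proof. reflexivity. Qed.

Lemma Rsum_Re_mult_conj (y : C) (u : nat -> C) (n : nat) :
  Rsum (fun j => Re (y * Cconj (u j))) n = Re (y * Cconj (Csum u n)).
Proof.
  induction n as [|n IH]; cbn [Rsum Csum].
  - unfold Re; simpl; ring.
  - rewrite IH, Cplus_conj, <- Re_plus. f_equal. ring.
Qed.

(** Adding one term [q_D w^D] adds [|q_D|^2] on average, because the cross
    terms only involve powers of [w] with exponents strictly between [0] and
    [N], whose sums over the roots of unity vanish. *)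
Lemma parseval (q : nat -> C) (N D : nat) : (D <= N)%nat ->
  Rsum (fun j => Cmod (Csum (fun m => q m * cis (2 * PI / INR N * INR j) ^ m)%C D) ^ 2) N
  = INR N * Rsum (fun m => Cmod (q m) ^ 2) D.
Proof.
  set (z := fun j => cis (2 * PI / INR N * INR j)).
  assert (Hzz : forall j m, (z j ^ m * Cconj (z j ^ m))%C = 1%C).
  { intros j m. rewrite <- Cmod2_conj, Cmod_pow. unfold z.
    rewrite Cmod_cis, !pow1. reflexivity. }
  assert (Hcross : forall d D' x, (d <= D' < N)%nat ->
    Rsum (fun j => Re (Csum (fun m => q m * z j ^ m)%C d * Cconj (x * z j ^ D'))) N = 0).
  { induction d as [|d IH]; intros D' x Hd.
    - rewrite (Rsum_ext _ (fun _ => 0)), Rsum_const; [ring|].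
      intros i _. cbn [Csum]. rewrite Cmult_0_l. reflexivity.
    - rewrite (Rsum_ext _ (fun j =>
        Re (Csum (fun m => q m * z j ^ m)%C d * Cconj (x * z j ^ D'))
        + Re (q d * Cconj x * Cconj (z j ^ (D' - d))))).
      + rewrite Rsum_plus, IH by lia.
        rewrite (Rsum_Re_mult_conj (q d * Cconj x) (fun j => z j ^ (D' - d))%C).
        unfold z. rewrite roots_sum_zero by lia.
        unfold Re; simpl; ring.
      + intros j _. rewrite <- Re_plus. cbn [Csum]. f_equal.
        replace (z j ^ D')%C with (z j ^ d * z j ^ (D' - d))%C
          by (rewrite <- Cpow_add_r; f_equal; lia).
        rewrite Cmult_plus_distr_r. f_equal.
        rewrite !Cmult_conj.
        transitivity (q d * Cconj x * Cconj (z j ^ (D' - d)) * (z j ^ d * Cconj (z j ^ d)))%C;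
          [ring|]. rewrite Hzz. ring. }
  induction D as [|D IH]; intros HD.
  - simpl. rewrite (Rsum_ext _ (fun _ => 0)), Rsum_const; [ring|].
    intros; rewrite Cmod_0; ring.
  - cbn [Csum]. change (Rsum ?u (S D)) with (Rsum u D + u D).
    rewrite (Rsum_ext _ (fun j =>
      (Cmod (Csum (fun m => q m * z j ^ m)%C D) ^ 2 + Cmod (q D) ^ 2)
      + 2 * Re (Csum (fun m => q m * z j ^ m)%C D * Cconj (q D * z j ^ D)))).
    + rewrite Rsum_plus, Rsum_scal, Hcross by lia.
      rewrite Rsum_plus, Rsum_const. unfold z at 1. rewrite IH by lia. ring.
    + intros j _. rewrite Cmod2_plus. f_equal. f_equal.
      rewrite Cmod_mult, Cmod_pow. unfold z. rewrite Cmod_cis, pow1. ring.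
Qed.

(** * Bounded power series and their truncations *)

(** This is [|w^k h(w)| <= 1] for [h(w) = sum c_n w^n] on the unit disk. *)
Definition bounded_series (k : nat) (c : nat -> C) : Prop :=
  forall w : C, Cmod w < 1 -> exists l : C, Cmod l <= 1 /\
    @is_series C_AbsRing C_NormedModule (fun n => c n * w ^ (k + n))%C l.

Lemma Cseries_eps (u : nat -> C) (l : C) :
  @is_series C_AbsRing C_NormedModule u l ->
  forall eps, 0 < eps -> exists N, forall n, (N <= n)%nat -> Cmod (Csum u n - l) < eps.
Proof.
  intros H eps He.
  destruct (proj1 (filterlim_locally_ball_norm _ _) H (mkposreal eps He)) as [N HN].
  exists (S N). intros [|n] Hn; [lia|].
  specialize (HN n ltac:(lia)). unfold ball_norm in HN.
  rewrite <- Csum_sum_n. exact HN.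
Qed.

Lemma Cseries_terms_bounded (u : nat -> C) (l : C) :
  @is_series C_AbsRing C_NormedModule u l ->
  exists B, 0 <= B /\ forall n, Cmod (u n) <= B.
Proof.
  intros H. destruct (Cseries_eps _ _ H 1 ltac:(lra)) as [N HN].
  exists (2 + Rsum (fun i => Cmod (u i)) N).
  assert (H0 : forall n, 0 <= Rsum (fun i => Cmod (u i)) n)
    by (intros; apply Rsum_nonneg; intros; apply Cmod_ge_0).
  split; [specialize (H0 N); lra|]. intros n.
  destruct (Nat.le_gt_cases N n) as [Hn|Hn].
  - pose proof (HN n Hn) as H1. pose proof (HN (S n) ltac:(lia)) as H2.
    replace (u n) with ((Csum u (S n) - l) + - (Csum u n - l))%C
      by (cbn [Csum]; ring).
    eapply Rle_trans; [apply Cmod_triangle|]. rewrite Cmod_opp. specialize (H0 N); lra.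
  - apply Rle_trans with (Rsum (fun i => Cmod (u i)) (S n)).
    + cbn [Rsum]. specialize (H0 n). lra.
    + assert (Rsum (fun i => Cmod (u i)) (S n) <= Rsum (fun i => Cmod (u i)) N)
        by (apply Rsum_mono; [intros; apply Cmod_ge_0|lia]). lra.
Qed.

Lemma geom_Rsum_le (q : R) (L n : nat) : 0 < q < 1 ->
  Rsum (fun i => q ^ (L + i)) n <= q ^ L / (1 - q).
Proof.
  intros Hq.
  assert (H : Rsum (fun i => q ^ (L + i)) n = (q ^ L - q ^ (L + n)) / (1 - q)).
  { induction n as [|n IH]; cbn [Rsum].
    - rewrite Nat.add_0_r. field. lra.
    - rewrite IH, Nat.add_succ_r. simpl. field. lra. }
  rewrite H. apply Rmult_le_compat_r; [left; apply Rinv_0_lt_compat; lra|].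
  assert (0 < q ^ (L + n)) by (apply pow_lt; lra). lra.
Qed.

(** The truncations are nearly bounded by 1, uniformly on the circle of radius
    [q^2].  Taking the radius to be a square gives room for a geometric tail:
    the terms are bounded at the larger radius [q], so on the circle the [n]-th
    one is at most a constant times [q^n]. *)
Lemma partial_sums_almost_bounded (k : nat) (c : nat -> C) (q : R) :
  bounded_series k c -> 0 < q < 1 ->
  exists B, 0 <= B /\ forall (L : nat) (w : C), Cmod w = q * q ->
    (q * q) ^ k * Cmod (Csum (fun n => c n * w ^ n)%C L) <= 1 + B * q ^ L.
Proof.
  intros Hc Hq.
  destruct (Hc (RtoC q)) as [l0 [_ Hl0]].
  { rewrite Cmod_R, Rabs_pos_eq; lra. }
  destruct (Cseries_terms_bounded _ _ Hl0) as [B [HB0 HB]].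
  exists (B / (1 - q)). split.
  { apply Rmult_le_pos; [lra|]. left; apply Rinv_0_lt_compat; lra. }
  intros L w Hw.
  destruct (Hc w) as [l [Hl Hs]]; [rewrite Hw; nra|].
  set (u := fun n => (c n * w ^ (k + n))%C) in *.
  assert (Hu : forall n, Cmod (u n) <= B * q ^ n).
  { intros n. unfold u. specialize (HB n).
    rewrite Cmod_mult, Cmod_pow, Cmod_R, Rabs_pos_eq in HB by lra.
    rewrite Cmod_mult, Cmod_pow, Hw, Rpow_mult_distr, <- Rmult_assoc.
    assert (Hp : q ^ (k + n) <= q ^ n).
    { rewrite Rdef_pow_add. rewrite <- (Rmult_1_l (q ^ n)) at 2.
      apply Rmult_le_compat_r; [apply pow_le; lra|].
      rewrite <- (pow1 k). apply pow_incr; lra. }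
    apply Rmult_le_compat; auto; [apply Rmult_le_pos; [apply Cmod_ge_0|]|];
      apply pow_le; lra. }
  replace ((q * q) ^ k * Cmod (Csum (fun n => c n * w ^ n)%C L)) with (Cmod (Csum u L)).
  2: { rewrite <- Hw, <- Cmod_pow, <- Cmod_mult, <- Csum_scal. f_equal.
       apply Csum_ext. intros i _. unfold u. rewrite Cpow_add_r. ring. }
  apply le_epsilon. intros eps He.
  destruct (Cseries_eps _ _ Hs eps He) as [N HN].
  specialize (HN (L + N)%nat ltac:(lia)). rewrite Csum_add in HN.
  set (t := Csum (fun i => u (L + i)%nat) N) in *.
  assert (Ht : Cmod t <= B / (1 - q) * q ^ L).
  { eapply Rle_trans; [apply Cmod_Csum|].
    eapply Rle_trans; [apply (Rsum_le _ (fun i => B * q ^ (L + i)) N); auto|].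
    rewrite Rsum_scal.
    replace (B / (1 - q) * q ^ L) with (B * (q ^ L / (1 - q))) by (field; lra).
    apply Rmult_le_compat_l; [lra|]. now apply geom_Rsum_le. }
  replace (Csum u L) with ((Csum u L + t - l) + (l + - t))%C by ring.
  eapply Rle_trans; [apply Cmod_triangle|].
  pose proof (Cmod_triangle l (- t)) as H. rewrite Cmod_opp in H. lra.
Qed.

(** * Multiplication by a bounded function is a contraction *)

(** The coefficients of [w^i p(w)]. *)
Definition shift (p : nat -> C) (i m : nat) : C :=
  if (i <=? m)%nat then p (m - i)%nat else 0%C.

Lemma Csum_shift (p : nat -> C) (P L i : nat) (w : C) :
  (forall j, (P <= j)%nat -> p j = 0%C) -> (i < L)%nat ->
  Csum (fun m => shift p i m * w ^ m)%C (L + P)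
  = (w ^ i * Csum (fun j => p j * w ^ j) P)%C.
Proof.
  intros Hp Hi. replace (L + P)%nat with (i + (P + (L - i)))%nat by lia.
  rewrite Csum_add, Csum_zero, Csum_add, <- Csum_scal.
  - rewrite (Csum_zero (fun j => shift p i (i + (P + j)) * _)%C).
    + rewrite Cplus_0_l, Cplus_0_r. apply Csum_ext. intros j _. unfold shift.
      rewrite (proj2 (Nat.leb_le _ _)) by lia.
      replace (i + j - i)%nat with j by lia. rewrite Cpow_add_r. ring.
    + intros j _. unfold shift. rewrite (proj2 (Nat.leb_le _ _)) by lia.
      rewrite Hp by lia. ring.
  - intros j Hj. unfold shift. rewrite (proj2 (Nat.leb_gt _ _)) by lia. ring.
Qed.

Lemma Csum_product (c p : nat -> C) (P L : nat) (w : C) :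
  (forall j, (P <= j)%nat -> p j = 0%C) ->
  Csum (fun m => Csum (fun i => c i * shift p i m) L * w ^ m)%C (L + P)
  = (Csum (fun i => c i * w ^ i) L * Csum (fun j => p j * w ^ j) P)%C.
Proof.
  intros Hp.
  rewrite (Csum_ext _ (fun m => Csum (fun i => c i * (shift p i m * w ^ m)) L)%C).
  2: { intros m _. rewrite Cmult_comm, <- Csum_scal. apply Csum_ext. intros; ring. }
  rewrite <- (Csum_swap (fun i m => c i * (shift p i m * w ^ m))%C).
  rewrite Cmult_comm, <- Csum_scal. apply Csum_ext. intros i Hi.
  rewrite Csum_scal, Csum_shift by auto. ring.
Qed.

Definition conv (c p : nat -> C) (m : nat) : C :=
  Csum (fun i => c i * p (m - i)%nat)%C (S m).

Lemma conv_shift (c p : nat -> C) (L m : nat) : (m < L)%nat ->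
  Csum (fun i => c i * shift p i m)%C L = conv c p m.
Proof.
  intros Hm. replace L with (S m + (L - S m))%nat by lia.
  rewrite Csum_add, (Csum_zero (fun i => c (S m + i)%nat * _)%C).
  - rewrite Cplus_0_r. apply Csum_ext. intros i Hi. unfold shift.
    now rewrite (proj2 (Nat.leb_le _ _)) by lia.
  - intros i _. unfold shift. rewrite (proj2 (Nat.leb_gt _ _)) by lia. ring.
Qed.

(** The lower triangular Toeplitz matrices of [c] have operator norm at most 1. *)
Definition contractive (c : nat -> C) : Prop :=
  forall (p : nat -> C) (M : nat), (forall j, (M <= j)%nat -> p j = 0%C) ->
  Rsum (fun m => Cmod (conv c p m) ^ 2) M <= Rsum (fun j => Cmod (p j) ^ 2) M.

Lemma le_of_perturbation (X Y B q : R) : 0 <= Y -> 0 < q < 1 -> 0 <= B ->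
  (forall L : nat, X <= (1 + B * q ^ L) ^ 2 * Y) -> X <= Y.
Proof.
  intros HY Hq HB H.
  assert (Hl : is_lim_seq (fun L => (1 + B * q ^ L) ^ 2 * Y) ((1 + B * 0) ^ 2 * Y)).
  { assert (H1 : is_lim_seq (fun L => 1 + B * q ^ L) (1 + B * 0)).
    { apply is_lim_seq_plus'; [apply is_lim_seq_const|].
      apply is_lim_seq_mult'; [apply is_lim_seq_const|].
      apply is_lim_seq_geom. rewrite Rabs_pos_eq; lra. }
    apply is_lim_seq_mult'; [|apply is_lim_seq_const].
    simpl. apply is_lim_seq_mult'; auto.
    apply is_lim_seq_mult'; auto. apply is_lim_seq_const. }
  assert (Hc : is_lim_seq (fun _ => X) X) by apply is_lim_seq_const.
  pose proof (is_lim_seq_le _ _ _ _ H Hc Hl) as H2. simpl in H2. lra.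
Qed.

(** Lets the radius of the circle of averaging tend to 1. *)
Lemma le_of_radial (X Y : R) (e : nat) :
  (forall q, 0 < q < 1 -> q ^ e * X <= Y) -> X <= Y.
Proof.
  intros H.
  set (v := fun n : nat => 1 - / INR (S (S n))).
  assert (Hi : is_lim_seq (fun n => / INR (S (S n))) 0).
  { apply (is_lim_seq_incr_1 (fun n => / INR (S n))), (is_lim_seq_incr_1 (fun n => / INR n)).
    replace (Finite 0) with (Rbar_inv p_infty) by reflexivity.
    apply is_lim_seq_inv; [apply is_lim_seq_INR|discriminate]. }
  assert (Hp : forall d, is_lim_seq (fun n => v n ^ d) ((1 - 0) ^ d)).
  { induction d as [|d IH]; simpl; [apply is_lim_seq_const|].
    apply is_lim_seq_mult'; auto.
    apply is_lim_seq_minus'; [apply is_lim_seq_const|exact Hi]. }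
  assert (Hl : is_lim_seq (fun n => v n ^ e * X) ((1 - 0) ^ e * X))
    by (apply is_lim_seq_mult'; [apply Hp|apply is_lim_seq_const]).
  assert (Hle : forall n, v n ^ e * X <= Y).
  { intros n. apply H. unfold v. rewrite S_INR.
    assert (1 <= INR (S n)) by (rewrite S_INR; pose proof (pos_INR n); lra).
    assert (0 < / (INR (S n) + 1)) by (apply Rinv_0_lt_compat; lra).
    assert (/ (INR (S n) + 1) < 1) by (rewrite <- Rinv_1; apply Rinv_lt_contravar; lra).
    lra. }
  pose proof (is_lim_seq_le _ _ _ _ Hle Hl (is_lim_seq_const Y)) as H2.
  simpl in H2. rewrite Rminus_0_r, pow1 in H2. lra.
Qed.

(** The polynomial [S p], with [S] a long truncation of [h], satisfies
    [r^k |S p| <= (1 + eps) |p|] on the circle [|w| = r].  Averaging the squares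
    with Parseval's identity bounds the [l^2] norm of its coefficients, the
    first [M] of which are those of [h p].  Then [eps -> 0] and [r -> 1]. *)
Lemma contraction (k : nat) (c : nat -> C) : bounded_series k c -> contractive c.
Proof.
  intros Hc p M Hp.
  (* With [r = q^2], the factor [w^k] costs [r^(2k)], and replacing the weights
     [r^(2m)], [m < M], by a common lower bound costs [r^(2M)]. *)
  apply le_of_radial with (e := (4 * (k + M))%nat). intros q Hq.
  destruct (partial_sums_almost_bounded k c q Hc Hq) as [B [HB0 HB]].
  apply le_of_perturbation with B (q); auto.
  { apply Rsum_nonneg; intros; apply pow2_ge_0. }
  assert (Hr : 0 < q * q < 1) by nra.
  set (r := q * q) in *.
  intros L.
  (* The truncation keeps [M + L] terms, so that all of [c_0, ..., c_(M-1)] are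
     present; more roots of unity than coefficients avoid aliasing. *)
  set (D := (M + L + M)%nat). set (N := S D).
  set (Q := fun m => Csum (fun i => c i * shift p i m)%C (M + L)).
  assert (HQ := parseval (fun m => Q m * RtoC r ^ m)%C N D ltac:(lia)).
  assert (Hpp := parseval (fun m => p m * RtoC r ^ m)%C N M ltac:(lia)).
  assert (HN : 0 < INR N) by (apply lt_0_INR; lia).
  assert (Hrm : forall m, Cmod (RtoC r ^ m) = r ^ m).
  { intros m. rewrite Cmod_pow, Cmod_R, Rabs_pos_eq; lra. }
  assert (Hrle : forall m n, (m <= n)%nat -> r ^ n <= r ^ m).
  { intros m n Hmn. induction Hmn as [|n _ IH]; [lra|]. simpl.
    assert (0 < r ^ n) by (apply pow_lt; lra). nra. }
  assert (Hq1 : 0 <= B * q ^ (M + L) <= B * q ^ L).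
  { split; [apply Rmult_le_pos; auto; apply pow_le; lra|].
    apply Rmult_le_compat_l; auto. rewrite Rdef_pow_add.
    rewrite <- (Rmult_1_l (q ^ L)) at 2. apply Rmult_le_compat_r; [apply pow_le; lra|].
    rewrite <- (pow1 M). apply pow_incr; lra. }
  set (b := 1 + B * q ^ L).
  assert (Hpt : r ^ (2 * k) * (INR N * Rsum (fun m => Cmod (Q m * RtoC r ^ m) ^ 2) D)
    <= b ^ 2 * (INR N * Rsum (fun m => Cmod (p m * RtoC r ^ m) ^ 2) M)).
  { rewrite <- HQ, <- Hpp, <- !Rsum_scal. apply Rsum_le. intros j _.
    set (z := cis (2 * PI / INR N * INR j)).
    set (w := (RtoC r * z)%C).
    assert (Hw : Cmod w = r).
    { unfold w, z. rewrite Cmod_mult, Cmod_cis, Cmod_R, Rabs_pos_eq; lra. }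
    specialize (HB (M + L)%nat w Hw).
    rewrite (Csum_ext (fun m => Q m * _ * _)%C (fun m => Q m * w ^ m)%C)
      by (intros; unfold w; rewrite Cpow_mult_l; ring).
    rewrite (Csum_ext (fun m => p m * _ * _)%C (fun m => p m * w ^ m)%C)
      by (intros; unfold w; rewrite Cpow_mult_l; ring).
    unfold Q, D. rewrite Csum_product by auto.
    rewrite Cmod_mult, Nat.mul_comm, pow_mult, <- Rpow_mult_distr, <- Rpow_mult_distr.
    apply pow_incr. split.
    - apply Rmult_le_pos; [apply pow_le; lra|].
      apply Rmult_le_pos; apply Cmod_ge_0.
    - rewrite <- Rmult_assoc. apply Rmult_le_compat_r; [apply Cmod_ge_0|].
      unfold b; lra. }
  assert (Hpt2 : r ^ (2 * k) * Rsum (fun m => Cmod (Q m * RtoC r ^ m) ^ 2) D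
    <= b ^ 2 * Rsum (fun m => Cmod (p m * RtoC r ^ m) ^ 2) M).
  { apply Rmult_le_reg_l with (INR N); auto. lra. }
  assert (Hleft : r ^ (2 * M) * Rsum (fun m => Cmod (conv c p m) ^ 2) M
    <= Rsum (fun m => Cmod (Q m * RtoC r ^ m) ^ 2) D).
  { rewrite <- Rsum_scal.
    eapply Rle_trans; [|apply (Rsum_mono _ M D); [intros; apply pow2_ge_0|lia]].
    apply Rsum_le. intros m Hm. unfold Q. rewrite conv_shift by lia.
    rewrite Cmod_mult, Hrm, Rpow_mult_distr, <- pow_mult, Rmult_comm.
    apply Rmult_le_compat_l; [apply pow2_ge_0|]. apply Hrle. lia. }
  assert (Hright : Rsum (fun m => Cmod (p m * RtoC r ^ m) ^ 2) M
    <= Rsum (fun j => Cmod (p j) ^ 2) M).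
  { apply Rsum_le. intros m _. rewrite Cmod_mult, Hrm.
    apply pow_incr. split; [apply Rmult_le_pos; [apply Cmod_ge_0|apply pow_le; lra]|].
    rewrite <- (Rmult_1_r (Cmod (p m))) at 2. apply Rmult_le_compat_l; [apply Cmod_ge_0|].
    apply (Hrle 0%nat m); lia. }
  replace (q ^ (4 * (k + M))) with (r ^ (2 * k) * r ^ (2 * M)).
  2: { unfold r. rewrite <- Rdef_pow_add, Rpow_mult_distr, <- Rdef_pow_add. f_equal. lia. }
  rewrite Rmult_assoc.
  apply Rle_trans with (r ^ (2 * k) * Rsum (fun m => Cmod (Q m * RtoC r ^ m) ^ 2) D).
  - apply Rmult_le_compat_l; [apply pow_le; lra|exact Hleft].
  - eapply Rle_trans; [exact Hpt2|].
    apply Rmult_le_compat_l; [apply pow2_ge_0|exact Hright].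
Qed.

(** * Carlson's coefficient inequalities *)

Lemma Rsum_Sl (u : nat -> R) (n : nat) :
  Rsum u (S n) = u 0%nat + Rsum (fun i => u (S i)) n.
Proof.
  induction n as [|n IH]; [simpl; ring|].
  change (Rsum u (S (S n))) with (Rsum u (S n) + u (S n)). rewrite IH. simpl. ring.
Qed.

Lemma Rsum_rev (u : nat -> R) (n : nat) :
  Rsum u (S n) = Rsum (fun i => u (n - i)%nat) (S n).
Proof.
  induction n as [|n IH]; [reflexivity|].
  rewrite (Rsum_Sl (fun i => u (S n - i)%nat)). cbn [Nat.sub].
  rewrite <- IH. cbn [Rsum]. ring.
Qed.

Lemma Rsum_gap (u : nat -> R) (n M : nat) : (n < M)%nat ->
  (forall i, (n < i < M)%nat -> u i = 0) -> Rsum u (S M) = Rsum u (S n) + u M.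
Proof.
  intros HnM H. cbn [Rsum]. f_equal.
  induction HnM as [|M HnM IH]; [reflexivity|].
  cbn [Rsum]. rewrite IH, (H M) by (intros; try apply H; lia). ring.
Qed.

Lemma Csum_gap (u : nat -> C) (n M : nat) : (n < M)%nat ->
  (forall i, (n < i < M)%nat -> u i = 0%C) -> Csum u (S M) = (Csum u (S n) + u M)%C.
Proof.
  intros HnM H. cbn [Csum]. f_equal.
  induction HnM as [|M HnM IH]; [reflexivity|].
  cbn [Csum]. rewrite IH, (H M) by (intros; try apply H; lia). ring.
Qed.

(** The polynomial [1] plus a block of the [n+1] top degrees up to [M], read
    backwards.  The reversal makes the coefficient of degree [M] of the product
    equal to [c_M] plus the pairing of [x] with [c_0, ..., c_n], while the
    lowest coefficients of the product stay those of [c]. *)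
Definition test_vector (M n : nat) (x : nat -> C) (j : nat) : C :=
  if (j =? 0)%nat then 1%C
  else if (M <=? j + n)%nat && (j <=? M)%nat then x (M - j)%nat else 0%C.

Lemma test_vector_0 M n x : test_vector M n x 0 = 1%C.
Proof. reflexivity. Qed.

Lemma test_vector_block M n x j :
  (0 < j)%nat -> (M <= j + n)%nat -> (j <= M)%nat ->
  test_vector M n x j = x (M - j)%nat.
Proof.
  intros. unfold test_vector. destruct j; [lia|]. simpl Nat.eqb. cbv iota.
  rewrite !(proj2 (Nat.leb_le _ _)) by lia. reflexivity.
Qed.

Lemma test_vector_zero M n x j :
  (0 < j)%nat -> (j + n < M)%nat \/ (M < j)%nat -> test_vector M n x j = 0%C.
Proof.
  intros Hj H. unfold test_vector. destruct j; [lia|]. simpl Nat.eqb. cbv iota.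
  destruct (Nat.leb_spec M (S j + n)), (Nat.leb_spec (S j) M); simpl; auto; lia.
Qed.

Lemma conv_test_low c M n x m : (m + n < M)%nat -> conv c (test_vector M n x) m = c m.
Proof.
  intros Hm. unfold conv. cbn [Csum]. rewrite Nat.sub_diag, test_vector_0, Csum_zero.
  - ring.
  - intros i Hi. rewrite test_vector_zero by lia. ring.
Qed.

(** For [M = 2n] the block starts at degree [n], so it perturbs the
    coefficient of that degree by its first entry. *)
Lemma conv_test_mid c n x : (0 < n)%nat ->
  conv c (test_vector (2 * n) n x) n = (c n + c 0%nat * x n)%C.
Proof.
  intros Hn. unfold conv. rewrite (Csum_gap _ 0 n) by (auto; intros i Hi;
    rewrite test_vector_zero by lia; ring).
  cbn [Csum]. rewrite Nat.sub_diag, test_vector_0, test_vector_block by lia.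
  replace (2 * n - (n - 0))%nat with n by lia. ring.
Qed.

Lemma conv_test_top c M n x : (n < M)%nat ->
  conv c (test_vector M n x) M = (c M + Csum (fun i => c i * x i) (S n))%C.
Proof.
  intros Hn. unfold conv. rewrite (Csum_gap _ n M) by (auto; intros i Hi;
    rewrite test_vector_zero by lia; ring).
  rewrite Nat.sub_diag, test_vector_0, (Csum_ext _ (fun i => c i * x i)%C).
  - ring.
  - intros i Hi. rewrite test_vector_block by lia. do 2 f_equal. lia.
Qed.

Lemma norm_test_vector M n x : (n < M)%nat ->
  Rsum (fun j => Cmod (test_vector M n x j) ^ 2) (S M)
  = 1 + Rsum (fun i => Cmod (x i) ^ 2) (S n).
Proof.
  intros Hn. rewrite Rsum_rev, (Rsum_gap _ n M) by (auto; intros i Hi;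
    rewrite test_vector_zero by lia; rewrite Cmod_0; ring).
  rewrite Nat.sub_diag, test_vector_0, Cmod_1, Rplus_comm, pow1. f_equal.
  apply Rsum_ext. intros i Hi. rewrite test_vector_block by lia. do 3 f_equal. lia.
Qed.

Lemma contractive_test c M n x : contractive c -> (n < M)%nat ->
  Rsum (fun m => Cmod (conv c (test_vector M n x) m) ^ 2) (S n)
  + Cmod (c M + Csum (fun i => c i * x i) (S n))%C ^ 2
  <= 1 + Rsum (fun i => Cmod (x i) ^ 2) (S n).
Proof.
  intros Hc Hn. rewrite <- norm_test_vector with (M := M) by auto.
  eapply Rle_trans; [|apply Hc].
  - rewrite <- conv_test_top by auto. cbn [Rsum]. apply Rplus_le_compat_r.
    change (Rsum (fun m => Cmod (conv c (test_vector M n x) m) ^ 2) (S n)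
      <= Rsum (fun m => Cmod (conv c (test_vector M n x) m) ^ 2) M).
    apply Rsum_mono; [intros; apply pow2_ge_0|lia].
  - intros j Hj. apply test_vector_zero; lia.
Qed.

(** For [s < 1] the best choice is [t = B / (1-s)], for which [B + t s = t]; the
    hypothesis then says that [(1-s) |t|^2 <= 1-s].  For [s >= 1], [t = 0] is enough. *)
Lemma defect_bound (B : C) (s : R) :
  (forall t : C, Cmod (B + t * RtoC s) ^ 2 <= (1 - s) + Cmod t ^ 2 * s) ->
  Cmod B <= 1 - s.
Proof.
  intros H. pose proof (Cmod_ge_0 B) as HB.
  assert (H0 := H 0%C). rewrite Cmult_0_l, Cplus_0_r, Cmod_0 in H0.
  destruct (Rle_lt_dec 1 s) as [Hs|Hs]; [nra|].
  assert (H1 := H (RtoC (/ (1 - s)) * B)%C).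
  replace (B + RtoC (/ (1 - s)) * B * RtoC s)%C with (RtoC (/ (1 - s)) * B)%C in H1.
  2: { transitivity ((1 + RtoC (/ (1 - s)) * RtoC s) * B)%C; [|ring].
       f_equal. rewrite <- RtoC_mult, <- RtoC_plus. f_equal. field. lra. }
  rewrite Cmod_mult, Cmod_R, Rabs_pos_eq in H1 by (left; apply Rinv_0_lt_compat; lra).
  set (v := / (1 - s) * Cmod B) in *.
  assert (Hv : Cmod B = (1 - s) * v) by (unfold v; field; lra).
  assert (0 <= v) by (unfold v; apply Rmult_le_pos; auto; left; apply Rinv_0_lt_compat; lra).
  assert (v ^ 2 <= 1) by nra. rewrite Hv. nra.
Qed.

Lemma Csum_mul_conj (c : nat -> C) (t : C) (n : nat) :
  Csum (fun i => c i * (t * Cconj (c i)))%C n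
  = (t * RtoC (Rsum (fun i => Cmod (c i) ^ 2)%R n))%C.
Proof.
  induction n as [|n IH]; cbn [Csum Rsum]; [ring|].
  rewrite IH, RtoC_plus, Cmod2_conj. ring.
Qed.

Lemma Rsum_mul_conj (c : nat -> C) (t : C) (n : nat) :
  Rsum (fun i => Cmod (t * Cconj (c i)) ^ 2) n
  = Cmod t ^ 2 * Rsum (fun i => Cmod (c i) ^ 2) n.
Proof.
  rewrite <- Rsum_scal. apply Rsum_ext. intros i _.
  rewrite Cmod_mult, Cmod_conj. ring.
Qed.

(** Test with the block [t conj(c_i)], [i <= n], for an arbitrary [t]: the pairing
    with [c] becomes [t] times the sum of squares, and [defect_bound] applies. *)
Lemma carlson_odd c n : contractive c ->
  Cmod (c (2 * n + 1)%nat) <= 1 - Rsum (fun i => Cmod (c i) ^ 2) (S n).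
Proof.
  intros Hc. apply defect_bound. intros t.
  pose proof (contractive_test c (2 * n + 1) n (fun i => t * Cconj (c i))%C Hc
    ltac:(lia)) as H.
  cbv beta in H. rewrite Csum_mul_conj, Rsum_mul_conj in H.
  rewrite (Rsum_ext _ (fun i => Cmod (c i) ^ 2)) in H.
  2: { intros i Hi. rewrite conv_test_low by lia. reflexivity. }
  lra.
Qed.

Lemma unimodular_multiple (u v : C) :
  exists e : C, Cmod e = 1 /\ Cmod (u + v * e) = Cmod u + Cmod v.
Proof.
  destruct (Ceq_dec u 0) as [->|Hu].
  { exists 1%C. rewrite Cmod_1, Cmult_1_r, Cplus_0_l, Cmod_0. split; ring. }
  destruct (Ceq_dec v 0) as [->|Hv].
  { exists 1%C. rewrite Cmod_1, Cmult_1_r, Cplus_0_r, Cmod_0. split; ring. }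
  pose proof (proj1 (Cmod_gt_0 u) Hu) as Hu0. pose proof (proj1 (Cmod_gt_0 v) Hv) as Hv0.
  exists (u * / v * RtoC (Cmod v / Cmod u))%C. split.
  - rewrite !Cmod_mult, Cmod_inv, Cmod_R, Rabs_pos_eq
      by (auto; left; now apply Rdiv_lt_0_compat). field. lra.
  - replace (u + v * (u * / v * RtoC (Cmod v / Cmod u)))%C
      with (u * RtoC (1 + Cmod v / Cmod u))%C by (rewrite RtoC_plus; field; exact Hv).
    rewrite Cmod_mult, Cmod_R, Rabs_pos_eq.
    + field. lra.
    + pose proof (Rdiv_lt_0_compat _ _ Hv0 Hu0). lra.
Qed.

(** For [M = 2n] the last entry [y] of the block also enters the coefficient of
    degree [n], which becomes [c_n + c_0 y].  Choose [|y| = d/(1+a)] with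
    [d = |c_n|], [a = |c_0|]: since [d - a |y| = |y|], the gain
    [|c_n + c_0 y|^2 >= |y|^2] compensates the cost [|y|^2] of [y], and the phase
    of [y] is free to align [c_n y] with [c_(2n)].  The odd case argument then
    bounds [|c_(2n)| + d |y|]. *)
Lemma carlson_even c n : contractive c -> (0 < n)%nat ->
  Cmod (c (2 * n)%nat) <=
  1 - Rsum (fun i => Cmod (c i) ^ 2) n - Cmod (c n) ^ 2 / (1 + Cmod (c 0%nat)).
Proof.
  intros Hc Hn.
  set (d := Cmod (c n)). set (a := Cmod (c 0%nat)).
  assert (Ha : 0 <= a) by apply Cmod_ge_0. assert (Hd : 0 <= d) by apply Cmod_ge_0.
  set (eta := d / (1 + a)).
  assert (Heta : 0 <= eta) by (apply Rmult_le_pos; auto; left; apply Rinv_0_lt_compat; lra).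
  assert (Hfix : d - a * eta = eta) by (unfold eta; field; lra).
  destruct (unimodular_multiple (c (2 * n)%nat) (c n * RtoC eta)%C) as [e [He Hal]].
  set (y := (RtoC eta * e)%C).
  assert (Heta_mod : Cmod (RtoC eta) = eta) by (rewrite Cmod_R, Rabs_pos_eq; lra).
  assert (Hy : Cmod y = eta) by (unfold y; rewrite Cmod_mult, He, Heta_mod; ring).
  replace (c n * RtoC eta * e)%C with (c n * y)%C in Hal by (unfold y; ring).
  rewrite Cmod_mult, Heta_mod in Hal. fold d in Hal.
  enough (HB : Cmod (c (2 * n)%nat + c n * y)%C <= 1 - Rsum (fun i => Cmod (c i) ^ 2) n).
  { replace (d ^ 2 / (1 + a)) with (d * eta) by (unfold eta; field; lra). lra. }
  apply defect_bound. intros t.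
  set (x := fun i => if (i <? n)%nat then (t * Cconj (c i))%C else y).
  assert (Hx : forall i, (i < n)%nat -> x i = (t * Cconj (c i))%C).
  { intros i Hi. unfold x. now rewrite (proj2 (Nat.ltb_lt _ _) Hi). }
  assert (Hxn : x n = y) by (unfold x; now rewrite Nat.ltb_irrefl).
  pose proof (contractive_test c (2 * n) n x Hc ltac:(lia)) as H.
  cbn [Csum Rsum] in H. rewrite Hxn, Hy, conv_test_mid, Hxn in H by auto.
  rewrite (Csum_ext _ (fun i => c i * (t * Cconj (c i)))%C) in H
    by (intros; now rewrite Hx).
  rewrite (Rsum_ext (fun i => Cmod (x i) ^ 2) (fun i => Cmod (t * Cconj (c i)) ^ 2)) in H
    by (intros; now rewrite Hx).
  rewrite Csum_mul_conj, Rsum_mul_conj in H.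
  rewrite (Rsum_ext _ (fun i => Cmod (c i) ^ 2)) in H
    by (intros; rewrite conv_test_low by lia; reflexivity).
  assert (Hmid : eta <= Cmod (c n + c 0%nat * y)).
  { pose proof (Cmod_triangle (c n + c 0%nat * y) (- (c 0%nat * y))) as T.
    replace (c n + c 0%nat * y + - (c 0%nat * y))%C with (c n) in T by ring.
    rewrite Cmod_opp, Cmod_mult, Hy in T. fold a d in T. lra. }
  rewrite (Cplus_comm (_ * RtoC _)%C), Cplus_assoc in H.
  assert (eta ^ 2 <= Cmod (c n + c 0%nat * y) ^ 2) by (apply pow_incr; lra).
  lra.
Qed.

(** * The sharp sum of the coefficient bounds *)

(** The last term on the right is the part of the bound not yet spent after
    the index [2N+1].  With it the induction step is an identity once the two
    coefficient bounds for the indices [2N+2] and [2N+3] are inserted. *)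
Lemma bohr_partial (u : nat -> R) (rho : R) (N : nat) :
  (forall n, 0 <= u n) -> 0 < rho < 1 ->
  (forall n, u (2 * n + 1)%nat <= 1 - Rsum (fun i => u i ^ 2) (S n)) ->
  (forall n, (0 < n)%nat ->
     u (2 * n)%nat <= 1 - Rsum (fun i => u i ^ 2) n - u n ^ 2 / (1 + u 0%nat)) ->
  Rsum (fun n => u n * rho ^ n) (2 * N + 2)
  + (1 / (1 + u 0%nat) + rho / (1 - rho)) * Rsum (fun n => u n ^ 2 * rho ^ (2 * n)) (S N)
  <= u 0%nat + u 0%nat ^ 2 / (1 + u 0%nat) + rho / (1 - rho)
     - (1 - Rsum (fun i => u i ^ 2) (S N)) * rho ^ (2 * N + 2) / (1 - rho).
Proof.
  intros Hu Hrho Hodd Heven.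
  set (a := u 0%nat) in *. assert (Ha : 0 <= a) by apply Hu.
  induction N as [|N IH].
  - specialize (Hodd 0%nat). simpl in Hodd |- *. fold a in Hodd |- *.
    match goal with |- ?L <= ?R =>
      assert (E : R - L = rho * (1 - (0 + a * (a * 1)) - u 1%nat)) by (field; lra) end.
    nra.
  - pose proof (Hodd (S N)) as Ho. pose proof (Heven (S N) ltac:(lia)) as He.
    replace (2 * S N + 2)%nat with (S (S (2 * N + 2))) by lia.
    replace (2 * S N + 1)%nat with (S (2 * N + 2)) in Ho by lia.
    replace (2 * S N)%nat with (2 * N + 2)%nat in He by lia.
    change (Rsum (fun n => u n * rho ^ n) (S (S (2 * N + 2)))) with
      (Rsum (fun n => u n * rho ^ n) (2 * N + 2) + u (2 * N + 2)%nat * rho ^ (2 * N + 2)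
       + u (S (2 * N + 2)) * rho ^ S (2 * N + 2)).
    change (Rsum (fun n => u n ^ 2 * rho ^ (2 * n)) (S (S N))) with
      (Rsum (fun n => u n ^ 2 * rho ^ (2 * n)) (S N) + u (S N) ^ 2 * rho ^ (2 * S N)).
    change (Rsum (fun i => u i ^ 2) (S (S N))) with
      (Rsum (fun i => u i ^ 2) (S N) + u (S N) ^ 2) in *.
    replace (2 * S N)%nat with (2 * N + 2)%nat by lia.
    set (X := rho ^ (2 * N + 2)) in *.
    replace (rho ^ S (S (2 * N + 2))) with (rho ^ 2 * X) by (unfold X; simpl; ring).
    replace (rho ^ S (2 * N + 2)) with (rho * X) by (unfold X; simpl; ring).
    assert (HX : 0 < X) by (apply pow_lt; lra).
    set (v := u (S N) ^ 2) in *.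
    set (s := Rsum (fun i => u i ^ 2) (S N)) in *.
    set (F := Rsum _ (2 * N + 2)) in *. set (G := Rsum (fun n => u n ^ 2 * _) (S N)) in *.
    set (u1 := u (2 * N + 2)%nat) in *. set (u2 := u (S (2 * N + 2))) in *.
    assert (H1 : u1 * X <= (1 - s - v / (1 + a)) * X) by (apply Rmult_le_compat_r; lra).
    assert (H2 : u2 * (rho * X) <= (1 - (s + v)) * (rho * X))
      by (apply Rmult_le_compat_r; [nra|lra]).
    assert (E : (1 - s) * X / (1 - rho) - (1 - (s + v)) * (rho ^ 2 * X) / (1 - rho)
      = (1 - s - v / (1 + a)) * X + (1 - (s + v)) * (rho * X)
        + (1 / (1 + a) + rho / (1 - rho)) * (v * X)) by (field; lra).
    lra.
Qed.

Lemma bohr_series (u : nat -> R) (rho : R) :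
  (forall n, 0 <= u n) -> 0 < rho < 1 ->
  (forall n, u (2 * n + 1)%nat <= 1 - Rsum (fun i => u i ^ 2) (S n)) ->
  (forall n, (0 < n)%nat ->
     u (2 * n)%nat <= 1 - Rsum (fun i => u i ^ 2) n - u n ^ 2 / (1 + u 0%nat)) ->
  ex_series (fun n => u n * rho ^ n) /\
  ex_series (fun n => u n ^ 2 * rho ^ (2 * n)) /\
  Series (fun n => u n * rho ^ n)
  + (1 / (1 + u 0%nat) + rho / (1 - rho)) * Series (fun n => u n ^ 2 * rho ^ (2 * n))
  <= u 0%nat + u 0%nat ^ 2 / (1 + u 0%nat) + rho / (1 - rho).
Proof.
  intros Hu Hrho Hodd Heven.
  assert (Hsq : forall n, 0 <= Rsum (fun i => u i ^ 2) n)
    by (intros; apply Rsum_nonneg; intros; apply pow2_ge_0).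
  assert (Hs1 : forall n, Rsum (fun i => u i ^ 2) (S n) <= 1).
  { intros n. specialize (Hodd n). specialize (Hu (2 * n + 1)%nat). lra. }
  assert (Hu1 : forall n, u n <= 1).
  { intros n. specialize (Hs1 n). specialize (Hsq n). cbn [Rsum] in Hs1.
    specialize (Hu n). nra. }
  set (F := fun n => u n * rho ^ n). set (G := fun n => u n ^ 2 * rho ^ (2 * n)).
  assert (Hp : forall n, 0 < rho ^ n) by (intros; apply pow_lt; lra).
  assert (HF0 : forall n, 0 <= F n)
    by (intros; unfold F; apply Rmult_le_pos; [auto|left; auto]).
  assert (HG0 : forall n, 0 <= G n)
    by (intros; unfold G; apply Rmult_le_pos; [apply pow2_ge_0|left; auto]).
  assert (HF1 : forall n, F n <= rho ^ n).
  { intros n. unfold F. specialize (Hp n). specialize (Hu1 n). specialize (Hu n). nra. }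
  assert (HGF : forall n, G n = F n ^ 2).
  { intros n. unfold F, G. rewrite Nat.mul_comm, pow_mult. ring. }
  assert (HG1 : forall n, G n <= rho ^ n).
  { intros n. rewrite HGF. specialize (HF1 n). specialize (HF0 n).
    assert (rho ^ n <= 1) by (rewrite <- (pow1 n); apply pow_incr; lra). nra. }
  assert (Hgeom : ex_series (fun n => rho ^ n))
    by (apply ex_series_geom; rewrite Rabs_pos_eq; lra).
  assert (HF : ex_series F).
  { apply (ex_series_le F (fun n => rho ^ n)); auto. intros n.
    change (Rabs (F n) <= rho ^ n). rewrite Rabs_pos_eq; auto. }
  assert (HG : ex_series G).
  { apply (ex_series_le G (fun n => rho ^ n)); auto. intros n.
    change (Rabs (G n) <= rho ^ n). rewrite Rabs_pos_eq; auto. }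
  split; [exact HF|]. split; [exact HG|].
  assert (Ha : 0 <= u 0%nat) by apply Hu.
  set (K := 1 / (1 + u 0%nat) + rho / (1 - rho)).
  set (A := u 0%nat + u 0%nat ^ 2 / (1 + u 0%nat) + rho / (1 - rho)).
  assert (HN : forall N, sum_n (fun n => F n + K * G n) N <= A).
  { intros N. rewrite Rsum_sum_n, Rsum_plus, Rsum_scal.
    pose proof (bohr_partial u rho N Hu Hrho Hodd Heven) as H.
    fold F G K A in H.
    assert (Rsum F (S N) <= Rsum F (2 * N + 2)) by (apply Rsum_mono; [auto|lia]).
    assert (0 <= (1 - Rsum (fun i => u i ^ 2) (S N)) * rho ^ (2 * N + 2) / (1 - rho)).
    { apply Rmult_le_pos; [apply Rmult_le_pos|].
      - specialize (Hs1 N). lra.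
      - left; auto.
      - left; apply Rinv_0_lt_compat; lra. }
    unfold F, G in *. lra. }
  assert (HS : is_series (fun n => F n + K * G n) (Series F + K * Series G)).
  { apply (is_series_plus F (fun n => K * G n)).
    - now apply Series_correct.
    - apply (is_series_scal_l K G). now apply Series_correct. }
  exact (is_lim_seq_le _ _ (Finite _) (Finite _) HN HS (is_lim_seq_const A)).
Qed.

(** * Monotonicity in the radius *)

Lemma bohr_radius_value (k : nat) (r : R) : 0 < r < 1 ->
  r ^ (k + 1) - 3 * r ^ k - 2 * r + 2 = 0 ->
  r ^ k * (3 / 2 + r / (1 - r)) = 1.
Proof.
  intros Hr H. rewrite pow_add, pow_1 in H.
  replace (r ^ k * (3 / 2 + r / (1 - r))) with (r ^ k * (3 - r) / (2 * (1 - r)))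
    by (field; lra).
  replace (r ^ k * (3 - r)) with (2 * (1 - r)) by lra. field. lra.
Qed.

Lemma bohr_radius_factor_lt (r s : R) : 0 < r -> r < s -> s < 1 ->
  r / (1 - r) < s / (1 - s).
Proof.
  intros H0 H1 H2.
  replace (r / (1 - r)) with (/ (1 - r) - 1) by (field; lra).
  replace (s / (1 - s)) with (/ (1 - s) - 1) by (field; lra).
  assert (/ (1 - r) < / (1 - s)) by (apply Rinv_lt_contravar; nra). lra.
Qed.

Lemma bohr_radius_mono_lt (k : nat) (r s : R) : 0 < r -> r < s -> s < 1 ->
  r ^ k * (3 / 2 + r / (1 - r)) < s ^ k * (3 / 2 + s / (1 - s)).
Proof.
  intros H0 H1 H2.
  pose proof (bohr_radius_factor_lt r s H0 H1 H2).
  assert (0 < r ^ k) by (apply pow_lt; lra).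
  assert (r ^ k <= s ^ k) by (apply pow_incr; lra).
  assert (0 < r / (1 - r)) by (apply Rdiv_lt_0_compat; lra).
  apply Rlt_le_trans with (r ^ k * (3 / 2 + s / (1 - s))).
  - apply Rmult_lt_compat_l; lra.
  - apply Rmult_le_compat_r; lra.
Qed.

(** * The inequality on the disk of the given parameter *)

Definition normalized (gamma : R) (k : nat) (a : nat -> C) (n : nat) : C :=
  (a (k + n)%nat * RtoC (/ (1 - gamma) ^ (k + n)))%C.

Lemma Cmod_normalized gamma k a n : gamma < 1 ->
  Cmod (normalized gamma k a n) = Cmod (a (k + n)%nat) / (1 - gamma) ^ (k + n).
Proof.
  intros Hg. unfold normalized. rewrite Cmod_mult, Cmod_R, Rabs_pos_eq; [reflexivity|].
  left. apply Rinv_0_lt_compat, pow_lt. lra.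
Qed.

Lemma bounded_series_normalized gamma k a f : gamma < 1 ->
  (forall z, Omega gamma z -> Cmod (f z) <= 1) -> has_expansion gamma k a f ->
  bounded_series k (normalized gamma k a).
Proof.
  intros Hg Hf He w Hw.
  set (z := (w * RtoC (/ (1 - gamma)) - RtoC (gamma / (1 - gamma)))%C).
  assert (Hz : (z + RtoC (gamma / (1 - gamma)))%C = (w * RtoC (/ (1 - gamma)))%C)
    by (unfold z; ring).
  assert (Hi : 0 < / (1 - gamma)) by (apply Rinv_0_lt_compat; lra).
  assert (HO : Omega gamma z).
  { unfold Omega. rewrite Hz, Cmod_mult, Cmod_R, Rabs_pos_eq by lra.
    apply Rmult_lt_compat_r; auto. }
  exists (f z). split; [auto|].
  assert (Hterm : forall n, (a (k + n)%nat * (z + RtoC (gamma / (1 - gamma))) ^ (k + n)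
    = normalized gamma k a n * w ^ (k + n))%C).
  { intros n. rewrite Hz. unfold normalized. rewrite Cpow_mult_l, <- RtoC_pow, pow_inv. ring. }
  exact (is_series_ext _ _ _ Hterm (He z HO)).
Qed.

Lemma majorant_term_normalized gamma k a rho n : gamma < 1 ->
  majorant_term gamma k a rho n
  = rho ^ k * (Cmod (normalized gamma k a n) * rho ^ n).
Proof.
  intros Hg. unfold majorant_term. rewrite Cmod_normalized, (pow_add rho) by auto. ring.
Qed.

Lemma normsq_term_normalized gamma k a rho n : gamma < 1 ->
  normsq_term gamma k a rho n
  = rho ^ (2 * k) * (Cmod (normalized gamma k a n) ^ 2 * rho ^ (2 * n)).
Proof.
  intros Hg. unfold normsq_term. rewrite Cmod_normalized by auto.
  replace (2 * (k + n))%nat with ((k + n) * 2)%nat by lia.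
  rewrite (pow_mult (1 - gamma)).
  replace ((k + n) * 2)%nat with (2 * k + 2 * n)%nat by lia.
  rewrite (pow_add rho). field.
  apply Rgt_not_eq, pow_lt; lra.
Qed.

Lemma bohr_lhs_normalized gamma k a rho (u : nat -> R) : gamma < 1 -> 0 < rho < 1 ->
  (forall n, u n = Cmod (normalized gamma k a n)) ->
  bohr_lhs gamma k a rho
  = rho ^ k * (Series (fun n => u n * rho ^ n)
      + (1 / (1 + u 0%nat) + rho / (1 - rho)) * Series (fun n => u n ^ 2 * rho ^ (2 * n))).
Proof.
  intros Hg Hr Hu. unfold bohr_lhs, normsq.
  rewrite (Series_ext (majorant_term _ _ _ _) (fun n => rho ^ k * (u n * rho ^ n)))
    by (intros; rewrite Hu; now apply majorant_term_normalized).
  rewrite (Series_ext (normsq_term _ _ _ _)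
    (fun n => rho ^ (2 * k) * (u n ^ 2 * rho ^ (2 * n))))
    by (intros; rewrite Hu; now apply normsq_term_normalized).
  rewrite !Series_scal_l.
  replace (Cmod (a k) / (1 - gamma) ^ k) with (u 0%nat).
  2: { rewrite Hu, Cmod_normalized by auto. now rewrite Nat.add_0_r. }
  assert (Hk : 0 < rho ^ k) by (apply pow_lt; lra).
  replace (1 - Z.of_nat k)%Z with (1 + - Z.of_nat k)%Z by ring.
  rewrite powerRZ_add, powerRZ_1, powerRZ_neg', <- pow_powerRZ by lra.
  replace (rho ^ (2 * k)) with (rho ^ k * rho ^ k) by (rewrite <- pow_add; f_equal; lia).
  assert (0 <= u 0%nat) by (rewrite Hu; apply Cmod_ge_0).
  field. lra.
Qed.

(** The worst case of the sum is [|c_0| = 1], by monotonicity of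
    [a + a^2/(1+a)]. *)
Lemma bohr_lhs_le gamma k a f rho : 0 <= gamma < 1 -> 0 < rho < 1 ->
  classB (Omega gamma) f -> has_expansion gamma k a f ->
  bohr_converges gamma k a rho /\
  bohr_lhs gamma k a rho <= rho ^ k * (3 / 2 + rho / (1 - rho)).
Proof.
  intros Hg Hr [_ Hf] He.
  set (c := normalized gamma k a). set (u := fun n => Cmod (c n)).
  assert (Hc : contractive c).
  { apply (contraction k), (bounded_series_normalized gamma k a f); tauto. }
  assert (Hu : forall n, 0 <= u n) by (intros; apply Cmod_ge_0).
  destruct (bohr_series u rho Hu Hr (fun n => carlson_odd c n Hc)
    (fun n => carlson_even c n Hc)) as [H1 [H2 H3]].
  split.
  - split.
    + apply ex_series_ext with (fun n => rho ^ k * (u n * rho ^ n)).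
      * intros n. symmetry. now apply majorant_term_normalized.
      * apply (ex_series_scal_l (rho ^ k) (fun n => u n * rho ^ n) H1).
    + apply ex_series_ext with (fun n => rho ^ (2 * k) * (u n ^ 2 * rho ^ (2 * n))).
      * intros n. symmetry. now apply normsq_term_normalized.
      * apply (ex_series_scal_l (rho ^ (2 * k)) (fun n => u n ^ 2 * rho ^ (2 * n)) H2).
  - rewrite (bohr_lhs_normalized gamma k a rho u) by (auto; apply Hg).
    apply Rmult_le_compat_l; [apply pow_le; lra|].
    eapply Rle_trans; [exact H3|]. apply Rplus_le_compat_r.
    assert (Hu0 : u 0%nat <= 1).
    { pose proof (carlson_odd c 0 Hc) as H. cbn [Rsum] in H.
      fold (u 0%nat) in H. pose proof (Cmod_ge_0 (c (2 * 0 + 1)%nat)).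
      specialize (Hu 0%nat). nra. }
    specialize (Hu 0%nat). set (t := u 0%nat) in *.
    assert (t ^ 2 / (1 + t) <= 1 / 2) by (apply Rle_div_l; nra). lra.
Qed.

(** * The extremal monomial *)

Lemma Cpow_derivable (g : C -> C) (z : C) (k : nat) :
  @ex_derive C_AbsRing (AbsRing_NormedModule C_AbsRing) g z ->
  @ex_derive C_AbsRing (AbsRing_NormedModule C_AbsRing) (fun x => Cpow (g x) k) z.
Proof.
  intros [dg Hg]. induction k as [|k [d IH]].
  - simpl. apply ex_derive_const.
  - eexists. apply (is_derive_mult (K := C_AbsRing) g (fun x => Cpow (g x) k) z _ _ Hg IH).
    exact Cmult_comm.
Qed.

(** The complex numbers carry two normed module structures over themselves,
    with different uniform structures but the same norm.  The product rule
    lives in the one attached to the absolute ring. *)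
Lemma ex_derive_C (f : C -> C) (z : C) :
  @ex_derive C_AbsRing (AbsRing_NormedModule C_AbsRing) f z ->
  @ex_derive C_AbsRing C_NormedModule f z.
Proof.
  intros [l [[H1 H2 H3] Hd]]. exists l. split.
  - split; [exact H1|exact H2|exact H3].
  - exact Hd.
Qed.

(** In the coordinate of the unit disk this is [w^k]. *)
Definition monomial (gamma : R) (k : nat) (z : C) : C :=
  ((RtoC (1 - gamma) * (z + RtoC (gamma / (1 - gamma)))) ^ k)%C.

Definition monomial_coeff (gamma : R) (k n : nat) : C :=
  if (n =? k)%nat then RtoC ((1 - gamma) ^ k) else 0%C.

Lemma monomial_classB gamma k : gamma < 1 -> classB (Omega gamma) (monomial gamma k).
Proof.
  intros Hg. split; intros z Hz.
  - apply ex_derive_C, Cpow_derivable. eexists.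
    apply (is_derive_mult (K := C_AbsRing) (fun _ => RtoC (1 - gamma))
      (fun z => z + RtoC (gamma / (1 - gamma)))%C z).
    + apply is_derive_const.
    + apply (is_derive_plus (K := C_AbsRing) (fun z => z)).
      * apply is_derive_id.
      * apply is_derive_const.
    + exact Cmult_comm.
  - unfold monomial. rewrite Cmod_pow, Cmod_mult, Cmod_R, Rabs_pos_eq by lra.
    apply Rle_trans with (1 ^ k); [apply pow_incr; split|rewrite pow1; lra].
    + apply Rmult_le_pos; [lra|apply Cmod_ge_0].
    + apply (Rlt_div_r _ 1 (1 - gamma)) in Hz; lra.
Qed.

Lemma monomial_coeff_shift gamma k n :
  monomial_coeff gamma k (k + n) = if (n =? 0)%nat then RtoC ((1 - gamma) ^ k) else 0%C.
Proof.
  unfold monomial_coeff. destruct n as [|n].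
  - now rewrite Nat.add_0_r, Nat.eqb_refl.
  - now rewrite (proj2 (Nat.eqb_neq (k + S n) k)) by lia.
Qed.

Lemma is_series_single (K : AbsRing) (V : NormedModule K) (u : nat -> V) :
  (forall n, u (S n) = zero) -> is_series u (u 0%nat).
Proof.
  intros H. apply (filterlim_ext (fun _ => u 0%nat)); [|apply filterlim_const].
  induction x as [|n IH]; [now rewrite sum_O|].
  now rewrite sum_Sn, <- IH, H, plus_zero_r.
Qed.

Lemma Series_single (u : nat -> R) : (forall n, u (S n) = 0) -> Series u = u 0%nat.
Proof. intros H. apply is_series_unique. now apply is_series_single. Qed.

Lemma monomial_expansion gamma k :
  has_expansion gamma k (monomial_coeff gamma k) (monomial gamma k).
Proof.
  intros z _. set (w := (z + RtoC (gamma / (1 - gamma)))%C).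
  replace (monomial gamma k z)
    with (monomial_coeff gamma k (k + 0) * w ^ (k + 0))%C.
  - apply (is_series_single C_AbsRing C_NormedModule
      (fun n => monomial_coeff gamma k (k + n) * w ^ (k + n))%C).
    intros n. rewrite monomial_coeff_shift. apply Cmult_0_l.
  - rewrite monomial_coeff_shift, Nat.add_0_r. unfold monomial.
    now rewrite Cpow_mult_l, <- RtoC_pow.
Qed.

Lemma monomial_bohr_lhs gamma k rho : gamma < 1 -> 0 < rho < 1 ->
  bohr_lhs gamma k (monomial_coeff gamma k) rho = rho ^ k * (3 / 2 + rho / (1 - rho)).
Proof.
  intros Hg Hr.
  set (u := fun n => Cmod (normalized gamma k (monomial_coeff gamma k) n)).
  rewrite (bohr_lhs_normalized gamma k (monomial_coeff gamma k) rho u) by auto.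
  assert (H0 : u 0%nat = 1).
  { unfold u. rewrite Cmod_normalized, monomial_coeff_shift, Nat.add_0_r by auto.
    simpl Nat.eqb. cbv iota. pose proof (pow_lt (1 - gamma) k ltac:(lra)).
    rewrite Cmod_R, Rabs_pos_eq by lra. field. lra. }
  assert (HS : forall n, u (S n) = 0).
  { intros n. unfold u. rewrite Cmod_normalized, monomial_coeff_shift by auto.
    simpl Nat.eqb. cbv iota. rewrite Cmod_0. unfold Rdiv. ring. }
  rewrite (Series_single (fun n => u n * rho ^ n)) by (intros; rewrite HS; ring).
  rewrite (Series_single (fun n => u n ^ 2 * rho ^ (2 * n))) by (intros; rewrite HS; ring).
  rewrite H0. simpl. field. lra.
Qed.

(** * The Bohr radius *)

Theorem theorem3p3 (gamma : R) (hgamma : 0 <= gamma < 1) (k : nat)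
  (rhok : R) (hrhok : 0 < rhok < 1)
  (hroot : rhok ^ (k + 1) - 3 * rhok ^ k - 2 * rhok + 2 = 0) :
  (forall (f : C -> C) (a : nat -> C),
     classB (Omega gamma) f ->
     has_expansion gamma k a f ->
     forall rho : R, 0 < rho < 1 -> rho <= rhok ->
       bohr_converges gamma k a rho /\ bohr_lhs gamma k a rho <= 1) /\
  (forall rho : R, rhok < rho < 1 ->
     exists (f : C -> C) (a : nat -> C),
       classB (Omega gamma) f /\
       has_expansion gamma k a f /\
       bohr_converges gamma k a rho /\
       ~ (bohr_lhs gamma k a rho <= 1)).
Proof.
  pose proof (bohr_radius_value k rhok hrhok hroot) as Hval.
  split.
  - intros f a Hf He rho Hr Hle.
    destruct (bohr_lhs_le gamma k a f rho hgamma Hr Hf He) as [Hc Hb].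
    split; [exact Hc|]. eapply Rle_trans; [exact Hb|].
    destruct (Rle_lt_or_eq_dec _ _ Hle) as [Hlt| ->]; [|now right].
    pose proof (bohr_radius_mono_lt k rho rhok ltac:(lra) Hlt ltac:(lra)). lra.
  - intros rho Hr. exists (monomial gamma k), (monomial_coeff gamma k).
    pose proof (monomial_classB gamma k ltac:(lra)) as Hf.
    pose proof (monomial_expansion gamma k) as He.
    split; [exact Hf|]. split; [exact He|]. split.
    + now apply (bohr_lhs_le gamma k _ (monomial gamma k) rho hgamma ltac:(lra)).
    + rewrite monomial_bohr_lhs by lra.
      pose proof (bohr_radius_mono_lt k rhok rho ltac:(lra) ltac:(lra) ltac:(lra)). lra.
Qed.
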